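(* Let $\mathcal X=\{x\in\mathbb R^d: Ax\le b\}$ be a nonempty bounded polytope, let $x_0\in\mathcal X$, let $U\in\mathbb R^{d\times r}$ have linearly independent columns, and let $c\in\mathbb R^d$. If $\mathsf{Exact}(U,x_0,c)$ holds, i.e. $\mathcal X^\star(c)=T_{U,x_0}(F_{U,x_0}(c))$, then $$T_{U,x_0}\!\left(F_{U,x_0}(c)\cap\mathcal Z_{U,x_0}^\angle\right)=\mathcal X^\star(c)\cap\mathcal X^\angle .$$
   Context: For a polytope $P$, $P^\angle$ denotes its set of extreme points. For $c\in\mathbb R^d$, $\mathcal X^\star(c):=\operatorname*{arg\,min}_{x\in\mathcal X}c^\top x$ (the set of all minimizers). For $x_0\in\mathcal X$ and $U\in\mathbb R^{d\times r}$ with linearly independent columns: $T_{U,x_0}(z):=x_0+Uz$ for $z\in\mathbb R^r$; $\mathcal Z_{U,x_0}:=\{z\in\mathbb R^r: T_{U,x_0}(z)\in\mathcal X\}$; $F_{U,x_0}(c):=\operatorname*{arg\,min}_{z\in\mathcal Z_{U,x_0}}(U^\top c)^\top z$ (the set of all minimizers). $\mathsf{Exact}(U,x_0,c)$ is the statement $\mathcal X^\star(c)=T_{U,x_0}(F_{U,x_0}(c))$. *)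

(* Defs.v *)
From mathcomp Require Import all_boot all_order all_algebra.
From mathcomp Require Import all_classical all_reals all_analysis.
Import Order.TTheory GRing.Theory Num.Theory.
Import numFieldNormedType.Exports.

Set Implicit Arguments.
Unset Strict Implicit.
Unset Printing Implicit Defensive.

Local Open Scope classical_set_scope.
Local Open Scope ring_scope.

Definition polyhedron (R : realType) (m d : nat)
    (A : 'M[R]_(m, d)) (b : 'cV[R]_m) : set 'cV[R]_d :=
  [set x | forall i : 'I_m, (A *m x) i 0 <= b i 0].

Definition argmin (R : realType) (n : nat) (c : 'cV[R]_n)
    (P : set 'cV[R]_n) : set 'cV[R]_n :=
  [set x | P x /\ forall y, P y -> (c^T *m x) 0 0 <= (c^T *m y) 0 0].

Definition extreme_points (R : realType) (n : nat)
    (P : set 'cV[R]_n) : set 'cV[R]_n :=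
  [set x | P x /\ forall (y z : 'cV[R]_n) (t : R), P y -> P z ->
     0 < t < 1 -> x = t *: y + (1 - t) *: z -> y = x /\ z = x].

Definition lift_point (R : realType) (d r : nat) (U : 'M[R]_(d, r))
    (x0 : 'cV[R]_d) (z : 'cV[R]_r) : 'cV[R]_d := x0 + U *m z.

Definition reduced_set (R : realType) (d r : nat) (X : set 'cV[R]_d)
    (U : 'M[R]_(d, r)) (x0 : 'cV[R]_d) : set 'cV[R]_r :=
  [set z | X (lift_point U x0 z)].

Definition reduced_argmin (R : realType) (d r : nat) (X : set 'cV[R]_d)
    (U : 'M[R]_(d, r)) (x0 c : 'cV[R]_d) : set 'cV[R]_r :=
  argmin (U^T *m c) (reduced_set X U x0).

Definition exact_reduction (R : realType) (d r : nat) (X : set 'cV[R]_d)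
    (U : 'M[R]_(d, r)) (x0 c : 'cV[R]_d) : Prop :=
  argmin c X = lift_point U x0 @` reduced_argmin X U x0 c.

(* Main.v *)
Require Import Defs.
From mathcomp Require Import all_boot all_order all_algebra.
From mathcomp Require Import all_classical all_reals all_analysis.
From mathcomp Require Import lra.
Import Order.TTheory GRing.Theory Num.Theory.
Import numFieldNormedType.Exports.

Local Open Scope classical_set_scope.
Local Open Scope ring_scope.

(** A convex combination strictly between two feasible points averages their
    objective values, so it can be optimal only if both points are: the set of
    minimizers is a face of the feasible set ([argmin_face]).  Extremality of a
    minimizer is therefore decided inside the set of minimizers, for the full
    problem.  Exactness identifies that set with the reduced one through the
    lift, an injective map preserving affine combinations
    ([lift_point_inj], [lift_point_conv]), and such maps transport extremality
    in both directions.

    Only one direction uses the face property.  Extremality passes from a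
    lifted point to its preimage for every feasible set
    ([extreme_points_lift_inv]).  In the opposite direction, a feasible segment
    through a lifted point may leave the range of the lift; the face property
    together with exactness rules this out at a minimizer
    ([extreme_points_lift_argmin]). *)

Lemma argmin_face {R : realType} {n : nat} {c : 'cV[R]_n} {P : set 'cV[R]_n}
    {y z : 'cV[R]_n} {t : R} :
  P y -> P z -> 0 < t < 1 -> argmin c P (t *: y + (1 - t) *: z) ->
  argmin c P y /\ argmin c P z.
Proof.
move=> Py Pz /andP[t0 t1] [_ xmin].
have valE : (c^T *m (t *: y + (1 - t) *: z)) 0 0
    = t * (c^T *m y) 0 0 + (1 - t) * (c^T *m z) 0 0.
  by rewrite mulmxDr -!scalemxAr !mxE.
have xy := xmin y Py; have xz := xmin z Pz.
move: xy xz; rewrite valE => xy xz.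
(* The average is at most each of the two values, hence they coincide. *)
have yz : (c^T *m y) 0 0 = (c^T *m z) 0 0.
  apply/le_anti/andP; split.
    by rewrite -(ler_pM2l t0); lra.
  by rewrite -subr_ge0 -(pmulr_rge0 _ (_ : 0 < 1 - t)) ?subr_gt0//; lra.
by split; split=> // w Pw; have := xmin w Pw; rewrite valE yz; lra.
Qed.

Lemma lift_point_conv {R : realType} {d r : nat} (U : 'M[R]_(d, r))
    (x0 : 'cV[R]_d) (y z : 'cV[R]_r) (t : R) :
  lift_point U x0 (t *: y + (1 - t) *: z)
  = t *: lift_point U x0 y + (1 - t) *: lift_point U x0 z.
Proof.
rewrite /lift_point mulmxDr -!scalemxAr !scalerDr addrACA -scalerDl.
by rewrite [t + _]addrC subrK scale1r.
Qed.

Lemma lift_point_inj {R : realType} {d r : nat} {U : 'M[R]_(d, r)}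
    {x0 : 'cV[R]_d} :
  row_free U^T -> injective (lift_point U x0).
Proof.
move=> U_free y z /addrI /(congr1 trmx); rewrite !trmx_mul.
by move=> /(row_free_inj U_free) /trmx_inj.
Qed.

(** The lift carries a segment of the reduced set through [z] to a segment of
    [X] through the lifted point; the latter is degenerate, so by injectivity
    the former is too. *)
Lemma extreme_points_lift_inv {R : realType} {d r : nat} {X : set 'cV[R]_d}
    {U : 'M[R]_(d, r)} {x0 : 'cV[R]_d} {z : 'cV[R]_r} :
  row_free U^T -> extreme_points X (lift_point U x0 z) ->
  extreme_points (reduced_set X U x0) z.
Proof.
move=> U_free [Xz ext]; split=> // z1 z2 t Xz1 Xz2 t01 zE.
have [] := ext _ _ t Xz1 Xz2 t01; first by rewrite zE lift_point_conv.
by split; apply: (lift_point_inj U_free); eassumption.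
Qed.

(** The endpoints of a segment of [X] through an optimal lifted point are
    optimal, and exactness makes every optimal point a lifted one, so the whole
    segment comes from the reduced set, where [z] is extreme. *)
Lemma extreme_points_lift_argmin {R : realType} {d r : nat}
    {X : set 'cV[R]_d} {U : 'M[R]_(d, r)} {x0 c : 'cV[R]_d} {z : 'cV[R]_r} :
  row_free U^T -> exact_reduction X U x0 c ->
  reduced_argmin X U x0 c z -> extreme_points (reduced_set X U x0) z ->
  extreme_points X (lift_point U x0 z).
Proof.
move=> U_free exact Fz [Zz ext]; split=> // y w t Xy Xw t01 zE.
have zopt : argmin c X (lift_point U x0 z) by rewrite exact; exists z.
move: zopt; rewrite {1}zE => /(argmin_face Xy Xw t01); rewrite exact.
move=> [[z1 [Zz1 _] z1E] [z2 [Zz2 _] z2E]].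
have [] := ext z1 z2 t Zz1 Zz2 t01.
  apply: (lift_point_inj (x0 := x0) U_free).
  by rewrite zE lift_point_conv z1E z2E.
by rewrite -z1E -z2E => -> ->.
Qed.

Theorem corollary3 (R : realType) (m d r : nat)
    (A : 'M[R]_(m, d)) (b : 'cV[R]_m)
    (X_neq0 : polyhedron A b !=set0)
    (X_bounded : bounded_set (polyhedron A b))
    (x0 : 'cV[R]_d) (Xx0 : polyhedron A b x0)
    (U : 'M[R]_(d, r)) (U_free : row_free U^T)
    (c : 'cV[R]_d)
    (Uexact : exact_reduction (polyhedron A b) U x0 c) :
  lift_point U x0 @` (reduced_argmin (polyhedron A b) U x0 c
                      `&` extreme_points (reduced_set (polyhedron A b) U x0))
  = argmin c (polyhedron A b) `&` extreme_points (polyhedron A b).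
Proof.
rewrite [argmin _ _]Uexact; apply/seteqP; split=> [_ [z [Fz Ez] <-]|x].
  by split; [exists z|exact: extreme_points_lift_argmin Uexact Fz Ez].
move=> [[z Fz <-] Ex]; exists z => //.
by split; last exact: extreme_points_lift_inv Ex.
Qed.
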